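(* (1) The map $\lambda\mapsto L(\lambda)$ induces a bijection between $X(\infty)$ and the set of isomorphism classes of irreducible $\mathbf U(\infty)$-modules in the category $\mathcal C^{hi}$. (2) The map $\lambda\mapsto L(\lambda)$ induces a bijection between $X(\infty)$ and the set of isomorphism classes of irreducible $\mathbf U(\infty)$-modules in the category $\mathcal O$.
   Context: $v$ indeterminate. $\mathbf U(\infty)$ is the $\mathbb Q(v)$-algebra with generators $E_i,F_i,K_i,K_i^{-1}$ ($i\in\mathbb Z$) and relations: $K_iK_j=K_jK_i$, $K_iK_i^{-1}=1$; $K_iE_j=v^{\delta_{i,j}-\delta_{i,j+1}}E_jK_i$; $K_iF_j=v^{\delta_{i,j+1}-\delta_{i,j}}F_jK_i$; $E_iE_j=E_jE_i$, $F_iF_j=F_jF_i$ if $|i-j|>1$; $E_iF_j-F_jE_i=\delta_{i,j}\frac{\widetilde K_i-\widetilde K_i^{-1}}{v-v^{-1}}$, $\widetilde K_i=K_iK_{i+1}^{-1}$; $E_i^2E_j-(v+v^{-1})E_iE_jE_i+E_jE_i^2=0$ and likewise for $F$ if $|i-j|=1$. $X(\infty)$ is the set of all integer sequences $\lambda=(\lambda_i)_{i\in\mathbb Z}$ (no finiteness condition). $\alpha_i=\varepsilon_i-\varepsilon_{i+1}$ ($\varepsilon_i$ unit sequence); $\mu\le_{wt}\lambda$ iff $\lambda-\mu$ is a finite $\mathbb N$-linear combination of the $\alpha_i$; $(-\infty,\lambda]=\{\mu:\mu\le_{wt}\lambda\}$. For a $\mathbf U(\infty)$-module $M$ and $\lambda\in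 X(\infty)$, $M_\lambda=\{x:K_ix=v^{\lambda_i}x\ \forall i\}$, $\mathrm{wt}(M)=\{\lambda:M_\lambda\ne0\}$; $M$ is a weight module if $M=\bigoplus_\lambda M_\lambda$. $\mathcal C^{hi}$ is the full subcategory of weight modules $M$ such that for each $x\in M$ there is $n_0$ with $ux=0$ for every monomial $u$ in the $E_i$'s with at least $n_0$ factors. $\mathcal O$ is the full subcategory of weight modules with finite-dimensional weight spaces for which there are finitely many $\lambda^{(1)},\dots,\lambda^{(s)}\in X(\infty)$ with $\mathrm{wt}(M)\subseteq\bigcup_k(-\infty,\lambda^{(k)}]$. For $\lambda\in X(\infty)$, the Verma module is $M(\lambda)=\mathbf U(\infty)/(\sum_i\mathbf U(\infty)E_i+\sum_i\mathbf U(\infty)(K_i-v^{\lambda_i}))$; it has a unique maximal submodule, and $L(\lambda)$ denotes its unique irreducible quotient. *)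

(* Defs.v *)
From HB Require Import structures.
From mathcomp Require Import all_boot all_order all_algebra.
Set Implicit Arguments. Unset Strict Implicit. Unset Printing Implicit Defensive.
Import Order.TTheory GRing.Theory Num.Theory.
Local Open Scope ring_scope.

Definition Qv : fieldType := {fraction {poly rat}}.
Definition qv : Qv := FracField.tofrac ('X : {poly rat}).

Definition kd (i j : int) : int := (i == j)%:Z.

Definition weight := int -> int.

Definition alpha (i : int) : weight := fun k => kd k i - kd k (i + 1).

(* mu <=_wt lam : lam - mu is a finite N-combination of the alpha_i
   (a finite multiset s of indices). *)
Definition le_wt (mu lam : weight) : Prop :=
  exists s : seq int, forall k, lam k - mu k = \sum_(i <- s) alpha i k.

(* A U(oo)-module: a Q(v)-vector space M with linear operators
   E_i, F_i, K_i, K_i^{-1} (i in Z) satisfying the defining relations of U(oo).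
   (This is equivalent to a module over the presented algebra U(oo).) *)
Definition is_Umod (M : lmodType Qv) (E F Kp Km : int -> M -> M) : Prop :=
  (forall i, linear (E i) /\ linear (F i) /\ linear (Kp i) /\ linear (Km i)) /\
      (forall i j x, Kp i (Kp j x) = Kp j (Kp i x)) /\
      (forall i x, Kp i (Km i x) = x /\ Km i (Kp i x) = x) /\
      (forall i j x, Kp i (E j x) = qv ^ (kd i j - kd i (j + 1)) *: E j (Kp i x)
                  /\ Kp i (F j x) = qv ^ (kd i (j + 1) - kd i j) *: F j (Kp i x)) /\
      (forall i j x, (1 < `|i - j|)%R ->
          E i (E j x) = E j (E i x) /\ F i (F j x) = F j (F i x)) /\
      (forall i j x, E i (F j x) - F j (E i x) =
          if i == j then (qv - qv^-1)^-1 *: (Kp i (Km (i + 1) x) - Km i (Kp (i + 1) x))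
          else 0) /\
      (forall i j x, `|i - j| = 1 ->
          E i (E i (E j x)) - (qv + qv^-1) *: E i (E j (E i x)) + E j (E i (E i x)) = 0
       /\ F i (F i (F j x)) - (qv + qv^-1) *: F i (F j (F i x)) + F j (F i (F i x)) = 0).

Record Umod := {
  car :> lmodType Qv;
  uE : int -> car -> car;
  uF : int -> car -> car;
  uK : int -> car -> car;
  uKi : int -> car -> car;
  uax : is_Umod uE uF uK uKi }.
Arguments uE : clear implicits.
Arguments uF : clear implicits.
Arguments uK : clear implicits.
Arguments uKi : clear implicits.

Definition submod (M : Umod) (P : M -> Prop) : Prop :=
  [/\ P 0, (forall x y, P x -> P y -> P (x + y)),
      (forall (a : Qv) x, P x -> P (a *: x)) &
      (forall i x, P x -> [/\ P (uE M i x), P (uF M i x), P (uK M i x) & P (uKi M i x)])].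

Definition irreducible (M : Umod) : Prop :=
  (exists x : M, x != 0) /\
  forall P : M -> Prop, submod P -> (forall x, P x -> x = 0) \/ (forall x, P x).

Definition Umod_iso (M N : Umod) : Prop :=
  exists f : M -> N, [/\ linear f, bijective f &
    forall i x, [/\ f (uE M i x) = uE N i (f x), f (uF M i x) = uF N i (f x),
                    f (uK M i x) = uK N i (f x) & f (uKi M i x) = uKi N i (f x)]].

Definition in_wtsp (M : Umod) (lam : weight) (x : M) : Prop :=
  forall i, uK M i x = qv ^ (lam i) *: x.

Definition is_wt (M : Umod) (lam : weight) : Prop :=
  exists x : M, x != 0 /\ in_wtsp lam x.

Definition weight_module (M : Umod) : Prop :=
  forall x : M, exists (s : seq M) (lams : nat -> weight),
    (forall k, (k < size s)%N -> in_wtsp (lams k) s`_k) /\ x = \sum_(y <- s) y.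

Definition in_Chi (M : Umod) : Prop :=
  weight_module M /\
  forall x : M, exists n0 : nat, forall s : seq int, (n0 <= size s)%N ->
    foldr (fun i y => uE M i y) x s = 0.

Definition fin_dim_wtsp (M : Umod) : Prop :=
  forall lam, exists b : seq M, forall x, in_wtsp lam x ->
    exists c : seq Qv, x = \sum_(k < size b) c`_k *: b`_k.

Definition in_O (M : Umod) : Prop :=
  [/\ weight_module M, fin_dim_wtsp M &
      exists (n : nat) (lams : nat -> weight),
        forall mu, is_wt M mu -> exists k, (k < n)%N /\ le_wt mu (lams k)].

Definition generates (M : Umod) (x : M) : Prop :=
  forall P : M -> Prop, submod P -> P x -> forall y, P y.

(* M is a quotient of the Verma module M(lam): by the universal property of
   M(lam) = U/(sum U E_i + sum U (K_i - v^lam_i)), this means M is generated by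
   a vector of weight lam annihilated by all E_i (the image of 1). *)
Definition Verma_quotient (lam : weight) (M : Umod) : Prop :=
  exists x : M, [/\ in_wtsp lam x, (forall i, uE M i x = 0) & generates x].

(* M is (isomorphic to) L(lam), the unique irreducible quotient of M(lam). *)
Definition isL (lam : weight) (M : Umod) : Prop :=
  irreducible M /\ Verma_quotient lam M.

(* Main.v *)
(* Uniqueness: if x and y are highest weight vectors of weight lam generating irreducible
   modules M and N, the submodule of M * N generated by (x, y) is spanned by F-words applied
   to (x, y), so its lam-weight space is the line through (x, y); by irreducibility it is then
   the graph of an isomorphism.
   Existence: L(lam) is realized as the submodule generated by the delta function at the empty
   word in the full dual of the Verma module of the algebra without Serre relations (functions
   on words in Z), where a vector killed by all E_i is supported on the empty word; as the E_i
   act locally nilpotently, the submodule is irreducible.  The Serre relations come for free: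
   a Serre element in the F's commutes with all E_k, and one in the E's with all F_k. *)
From HB Require Import structures.
Require Import Defs.
From mathcomp Require Import all_boot all_order all_algebra.
From mathcomp Require Import boolp functions ring zify.

Set Implicit Arguments. Unset Strict Implicit. Unset Printing Implicit Defensive.
Import Order.TTheory GRing.Theory Num.Theory.
Local Open Scope ring_scope.

(** * Quantum integers *)

Lemma qv_neq0 : qv != 0.
Proof. by rewrite tofrac_eq0 polyX_eq0. Qed.

Lemma qv_expr_eq1 (n : nat) : qv ^+ n = 1 -> n = 0%N.
Proof.
rewrite /qv -rmorphXn -tofrac1 => /eqP; rewrite tofrac_eq => /eqP e.
have := congr1 (fun p : {poly rat} => size p) e.
by rewrite size_polyXn size_poly1; case.
Qed.

(** Comparing degrees in ['X] shows that [qv] is not a root of unity. This is what lets the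
    eigenvalues of the [K_i] tell weights apart. *)
Lemma qv_exprz_inj (m n : int) : qv ^ m = qv ^ n -> m = n.
Proof.
move=> e; apply/eqP; rewrite -subr_eq0; apply/eqP.
have: qv ^ (m - n) = 1.
  by rewrite (expfzDr _ _ qv_neq0) e -expfzDr ?qv_neq0 // subrr.
case: (m - n) => k.
  by rewrite -exprnP => /qv_expr_eq1 ->.
by rewrite NegzE -exprnN => /(congr1 GRing.inv); rewrite invrK invr1 => /qv_expr_eq1.
Qed.

(** The scalar by which [[E_i, F_i]] acts on a vector whose weight has [i]-th coroot value [m]. *)
Definition qint (m : int) : Qv := (qv - qv^-1)^-1 * (qv ^ m - qv ^ (- m)).

Lemma qintN (m : int) : qint (- m) = - qint m.
Proof. by rewrite /qint opprK -mulrN opprB. Qed.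

(** Both v and v^-1 are roots of t^2 - (v + v^-1) t + 1, so the sequences v^m and v^-m both satisfy
    this recurrence. *)
Lemma qint_rec (a b c : int) : b = a + 1 -> c = a + 2 ->
  qint a - (qv + qv^-1) * qint b + qint c = 0.
Proof.
move=> -> ->; rewrite -[2]/(1 + 1) /qint !opprD !(expfzDr _ _ qv_neq0) exprN1 expr1z.
have h := divff qv_neq0; move: (qv ^ a) (qv ^ - a) (qv - qv^-1)^-1 => x y d.
move: qv^-1 h => u; move: qv => q h.
transitivity (d * (x - y) * (1 - q * u)); first by ring.
by rewrite h; ring.
Qed.

Lemma qint_serre (a b c : int) : b = a - 2 -> c = a - 1 ->
  qint a + qint b - (qv + qv^-1) * qint c = 0.
Proof.
move=> hb hc; rewrite addrAC addrC addrA.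
have <- : qint b - (qv + qv^-1) * qint c + qint a = 0.
  by apply: qint_rec; rewrite ?hb ?hc; ring.
by rewrite addrAC.
Qed.

Definition coroot (i : int) (mu : weight) : int := mu i - mu (i + 1).
Definition wsub (mu nu : weight) : weight := fun k => mu k - nu k.
Definition wopp (mu : weight) : weight := fun k => - mu k.

Lemma coroot_sub i mu nu : coroot i (wsub mu nu) = coroot i mu - coroot i nu.
Proof. by rewrite /coroot /wsub; ring. Qed.

Lemma coroot_opp i mu : coroot i (wopp mu) = - coroot i mu.
Proof. by rewrite /coroot /wopp; ring. Qed.

Lemma coroot_alpha_same (i : int) : coroot i (alpha i) = 2.
Proof. by rewrite /coroot /alpha /kd; do !case: eqP => ? /=; lia. Qed.

Lemma coroot_alpha_adj (i j : int) : `|i - j| = 1 -> coroot i (alpha j) = -1.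
Proof. by rewrite /coroot /alpha /kd => h; do !case: eqP => ? /=; lia. Qed.

Lemma coroot_alpha_far (i j : int) : 1 < `|i - j| -> coroot i (alpha j) = 0.
Proof. by rewrite /coroot /alpha /kd => h; do !case: eqP => ? /=; lia. Qed.

Section LinearMaps.
Context (R : pzRingType) (V W : lmodType R) (f : V -> W) (hf : linear f).

Lemma lin_D x y : f (x + y) = f x + f y.
Proof. by have := hf 1 x y; rewrite !scale1r. Qed.

Lemma lin_0 : f 0 = 0.
Proof. by apply: (addrI (f 0)); rewrite -lin_D !addr0. Qed.

Lemma lin_Z a x : f (a *: x) = a *: f x.
Proof. by have := hf a x 0; rewrite !addr0 lin_0 addr0. Qed.

Lemma lin_N x : f (- x) = - f x.
Proof. by rewrite -scaleN1r lin_Z scaleN1r. Qed.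

Lemma lin_B x y : f (x - y) = f x - f y.
Proof. by rewrite lin_D lin_N. Qed.
End LinearMaps.

(** * Serre elements *)

Definition serre (V : lmodType Qv) (B : int -> V -> V) (i j : int) (x : V) : V :=
  B i (B i (B j x)) - (qv + qv^-1) *: B i (B j (B i x)) + B j (B i (B i x)).

(** Bookkeeping for [serre_comm]: [X1], [X2], [X3] are the three words applied to [A k x], while
    [P], [Q], [T] stand for [B i (B j x)], [B j (B i x)], [B i (B i x)], the words left when [A k]
    cancels one letter. *)
Lemma serre_collect (V : lmodType Qv) (t a1 a2 a3 a4 a5 a6 a7 a8 : Qv) (X1 X2 X3 P Q T : V) :
  X1 + a3 *: T + a1 *: P + a2 *: P - t *: (X2 + a6 *: P + a5 *: T + a4 *: Q)
    + (X3 + a6 *: Q + a8 *: Q + a7 *: T) =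
  X1 - t *: X2 + X3 + (a1 + a2 - t * a6) *: P + (a6 + a8 - t * a4) *: Q
    + (a3 - t * a5 + a7) *: T.
Proof.
rewrite !(scalerDr, scalerDl, scalerA, scaleNr, opprD) !addrA.
by rewrite [LHS](ACl (1*5*9*3*4*6*10*11*8*2*7*12))%AC.
Qed.

(* Applies both to (A, B) = (E, F) and, with negated weights, to (F, E). *)
Section SerreCommutation.
Context (V : lmodType Qv) (A B : int -> V -> V) (wt : weight -> V -> Prop).
Hypothesis linA : forall i, linear (A i).
Hypothesis linB : forall i, linear (B i).
Hypothesis wtB : forall mu j x, wt mu x -> wt (wsub mu (alpha j)) (B j x).
Hypothesis AB : forall mu i j x, wt mu x ->
  A i (B j x) = B j (A i x) + (if i == j then qint (coroot i mu) else 0) *: x.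

(** Moving [A k] to the right produces three correction terms. For [k = i] the first two
    coefficients, and for [k = j] the third, are three-term relations between quantum integers at
    consecutive arguments; the others vanish outright. *)
Lemma serre_comm mu i j k x : `|i - j| = 1 -> wt mu x ->
  A k (serre B i j x) = serre B i j (A k x).
Proof.
move=> hij hx.
have nij : i != j by apply/eqP => e; move: hij; rewrite e subrr.
have hji : `|j - i| = 1 by rewrite distrC.
have hi := wtB i hx; have hj := wtB j hx.
have hii := wtB i hi; have hji' := wtB j hi; have hij' := wtB i hj.
rewrite /serre !(lin_D (linA k), lin_N (linA k), lin_Z (linA k)).
rewrite (AB k i hij') (AB k i hj) (AB k j hx).
rewrite (AB k i hji') (AB k j hi) (AB k i hx).
rewrite (AB k j hii) (AB k i hi) (AB k i hx).
rewrite !(coroot_sub k mu, coroot_sub k (wsub mu _)); set m := coroot k mu.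
rewrite !(lin_D (linB _), lin_Z (linB _)).
rewrite serre_collect.
have vanish3 (a b c : Qv) (Y Y2 Y3 Y4 : V) : a = 0 -> b = 0 -> c = 0 ->
  Y + a *: Y2 + b *: Y3 + c *: Y4 = Y.
  by move=> -> -> ->; rewrite !scale0r !addr0.
apply: vanish3; have [eki|nki] := eqVneq k i.
- rewrite eki coroot_alpha_same (coroot_alpha_adj hij).
  by apply: qint_serre; ring.
- by rewrite mulr0 subr0 addr0.
- rewrite eki coroot_alpha_same (coroot_alpha_adj hij).
  by apply: qint_serre; ring.
- by rewrite mulr0 subr0 addr0.
- by rewrite eki (negbTE nij) mulr0 subr0 addr0.
have [ekj|nkj] := eqVneq k j; last by rewrite mulr0 subr0 addr0.
rewrite ekj (coroot_alpha_adj hji).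
by apply: qint_rec; ring.
Qed.

(** For distant indices the simple root of one pairs to zero with the coroot of the other, so the
    corrections from the two orders have equal coefficients and cancel. *)
Lemma far_comm mu i j k x : 1 < `|i - j| -> wt mu x ->
  A k (B i (B j x) - B j (B i x)) = B i (B j (A k x)) - B j (B i (A k x)).
Proof.
move=> hij hx.
have nij : i != j by apply/eqP => e; move: hij; rewrite e subrr.
have hji : 1 < `|j - i| by rewrite distrC.
have hi := wtB i hx; have hj := wtB j hx.
rewrite (lin_B (linA k)) (AB k i hj) (AB k j hx) (AB k j hi) (AB k i hx).
rewrite !(coroot_sub k mu); set m := coroot k mu.
rewrite !(lin_D (linB _), lin_Z (linB _)).
have [eki|nki] := eqVneq k i.
  rewrite eki (negbTE nij) (coroot_alpha_far hij) !scale0r !addr0.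
  by rewrite opprD addrACA subrr addr0.
have [ekj|nkj] := eqVneq k j; last by rewrite !scale0r !addr0.
rewrite ekj (coroot_alpha_far hji) !scale0r !addr0.
by rewrite opprD addrA addrAC addrK.
Qed.
End SerreCommutation.

(** * Weights and highest weight vectors *)

Lemma sum_alpha_count (s : seq int) (k : int) :
  \sum_(i <- s) alpha i k = (count_mem k s)%:Z - (count_mem (k - 1) s)%:Z.
Proof.
elim: s => [|i s IH]; first by rewrite big_nil subrr.
rewrite big_cons IH /= !PoszD /alpha /kd.
have -> : (k == i + 1) = (i == k - 1) by rewrite eq_sym eq_sym -subr_eq eq_sym.
by rewrite (eq_sym k i); ring.
Qed.

Lemma seq_int_lower_bound (s : seq int) : exists N : int, forall i, i \in s -> N < i.
Proof.
elim: s => [|j s [N hN]]; first by exists 0.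
exists (Num.min N (j - 1)) => i; rewrite inE => /orP [/eqP ->|/hN h].
  by rewrite gt_min; apply/orP; right; lia.
by rewrite gt_min h.
Qed.

(** Linear independence of the simple roots. The coefficient at [k] is the multiplicity of [k] minus
    that of [k - 1]; multiplicities vanish far to the left, so they are recovered by induction going
    right. *)
Lemma sum_alpha_perm (s t : seq int) :
  (forall k, \sum_(i <- s) alpha i k = \sum_(i <- t) alpha i k) -> perm_eq s t.
Proof.
move=> h; apply/allP => k _ /=; apply/eqP.
have [N hN] := seq_int_lower_bound (s ++ t).
have below (i : int) : i <= N -> count_mem i s = 0%N /\ count_mem i t = 0%N.
  by move=> hi; split; apply/count_memPn/negP => hm;
    have := hN i; rewrite mem_cat hm ?orbT => /(_ isT); rewrite ltNge hi.
have [hk|hk] := leP k N; first by have [-> ->] := below k hk.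
suff {k hk} H (n : nat) : count_mem (N + n%:Z) s = count_mem (N + n%:Z) t.
  by have := H `|k - N|%N; rewrite gez0_abs ?subr_ge0 ?ltW // addrCA subrr addr0.
elim: n => [|n IH]; first by have [|-> ->] := below (N + 0%:Z); rewrite ?addr0.
have := h (N + n.+1%:Z); rewrite !sum_alpha_count.
have -> : N + n.+1%:Z - 1 = N + n%:Z by lia.
by rewrite IH => /addIr [].
Qed.

Definition wadd (mu nu : weight) : weight := fun k => mu k + nu k.
Definition wword (lam : weight) (w : seq int) : weight :=
  fun k => lam k - \sum_(i <- w) alpha i k.

(** The relations of U(oo) minus the Serre relations and the commutation of distant generators. The
    weight arguments are made at this level so that they cover modules, pairs of modules and the
    dual built below. *)
Definition is_premod (V : lmodType Qv) (E F Kp Km : int -> V -> V) : Prop :=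
  [/\ forall i, [/\ linear (E i), linear (F i), linear (Kp i) & linear (Km i)],
      forall i j x, Kp i (Kp j x) = Kp j (Kp i x),
      forall i x, Kp i (Km i x) = x /\ Km i (Kp i x) = x,
      forall i j x, Kp i (E j x) = qv ^ alpha j i *: E j (Kp i x)
                 /\ Kp i (F j x) = qv ^ (- alpha j i) *: F j (Kp i x) &
      forall i j x, E i (F j x) - F j (E i x) =
          if i == j then (qv - qv^-1)^-1 *: (Kp i (Km (i + 1) x) - Km i (Kp (i + 1) x))
          else 0].

Lemma Umod_premod (M : Umod) : is_premod (uE M) (uF M) (uK M) (uKi M).
Proof.
have [lin [KK [KKm [KEF [_ [EF _]]]]]] := uax M.
split=> // [i|i j x]; first by have [? [? []]] := lin i.
have [-> ->] := KEF i j x; split => //.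
by rewrite /alpha opprB.
Qed.

Definition kwt (V : lmodType Qv) (Kp : int -> V -> V) (mu : weight) (x : V) : Prop :=
  forall i, Kp i x = qv ^ mu i *: x.

Definition Fspan (V : lmodType Qv) (F : int -> V -> V) (x y : V) : Prop :=
  exists s : seq (Qv * seq int), y = \sum_(p <- s) p.1 *: foldr F x p.2.

Section Premodule.
Context (V : lmodType Qv) (E F Kp Km : int -> V -> V).
Hypothesis pm : is_premod E F Kp Km.

Lemma premod_linE i : linear (E i). Proof. by case: pm => /(_ i) []. Qed.
Lemma premod_linF i : linear (F i). Proof. by case: pm => /(_ i) []. Qed.
Lemma premod_linKp i : linear (Kp i). Proof. by case: pm => /(_ i) []. Qed.
Lemma premod_linKm i : linear (Km i). Proof. by case: pm => /(_ i) []. Qed.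

Lemma kwt_ext mu nu x : mu =1 nu -> kwt Kp mu x -> kwt Kp nu x.
Proof. by move=> e h i; rewrite -e. Qed.

Lemma kwt_Km mu i x : kwt Kp mu x -> Km i x = qv ^ (- mu i) *: x.
Proof.
move=> h; have [_ _ /(_ i x) [_ e] _ _] := pm.
rewrite -{2}e h (lin_Z (premod_linKm i)) scalerA -expfzDr ?qv_neq0 //.
by rewrite addNr expr0z scale1r.
Qed.

Lemma kwt_E mu j x : kwt Kp mu x -> kwt Kp (wadd mu (alpha j)) (E j x).
Proof.
move=> h i; have [_ _ _ /(_ i j x) [-> _] _] := pm.
by rewrite h (lin_Z (premod_linE j)) scalerA -expfzDr ?qv_neq0 // addrC.
Qed.

Lemma kwt_F mu j x : kwt Kp mu x -> kwt Kp (wsub mu (alpha j)) (F j x).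
Proof.
move=> h i; have [_ _ _ /(_ i j x) [_ ->] _] := pm.
by rewrite h (lin_Z (premod_linF j)) scalerA -expfzDr ?qv_neq0 // addrC.
Qed.

Lemma kwt_EF mu i j x : kwt Kp mu x ->
  E i (F j x) = F j (E i x) + (if i == j then qint (coroot i mu) else 0) *: x.
Proof.
move=> h; have [_ _ _ _ /(_ i j x) e] := pm.
apply: (addIr (- F j (E i x))); rewrite e addrAC subrr add0r.
case: eqP => _; last by rewrite scale0r.
rewrite (kwt_Km _ h) (lin_Z (premod_linKp i)) !h (lin_Z (premod_linKm i)) (kwt_Km _ h).
rewrite !scalerA -scalerBl scalerA -!expfzDr ?qv_neq0 // /qint /coroot.
by congr (_ * (qv ^ _ - qv ^ _) *: _); rewrite ?opprB // addrC.
Qed.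

Lemma serre_F_E mu i j k x : `|i - j| = 1 -> kwt Kp mu x ->
  E k (serre F i j x) = serre F i j (E k x).
Proof.
exact: (serre_comm premod_linE premod_linF kwt_F kwt_EF).
Qed.

Lemma far_F_E mu i j k x : 1 < `|i - j| -> kwt Kp mu x ->
  E k (F i (F j x) - F j (F i x)) = F i (F j (E k x)) - F j (F i (E k x)).
Proof.
exact: (far_comm premod_linE premod_linF kwt_F kwt_EF).
Qed.

Lemma kwt_opp_E mu j x : kwt Kp (wopp mu) x -> kwt Kp (wopp (wsub mu (alpha j))) (E j x).
Proof.
by move/(kwt_E j); apply: kwt_ext => k; rewrite /wadd /wopp /wsub opprB addrC.
Qed.

(** Exchanging the roles of [E] and [F] changes the sign of the commutator; negating weights
    compensates, as [qint] is odd. *)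
Lemma kwt_opp_FE mu i j x : kwt Kp (wopp mu) x ->
  F i (E j x) = E j (F i x) + (if i == j then qint (coroot i mu) else 0) *: x.
Proof.
move=> h; rewrite (kwt_EF j i h) coroot_opp (eq_sym j) -addrA -scalerDl.
case: eqP => [->|_]; last by rewrite addr0 scale0r addr0.
by rewrite qintN addNr scale0r addr0.
Qed.

Lemma wopp_wopp mu : wopp (wopp mu) =1 mu.
Proof. by move=> k; rewrite /wopp opprK. Qed.

Lemma serre_E_F mu i j k x : `|i - j| = 1 -> kwt Kp mu x ->
  F k (serre E i j x) = serre E i j (F k x).
Proof.
move=> hij h.
apply: (serre_comm premod_linF premod_linE kwt_opp_E kwt_opp_FE (mu := wopp mu)) => //.
by apply: kwt_ext h => k'; rewrite wopp_wopp.
Qed.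

Lemma far_E_F mu i j k x : 1 < `|i - j| -> kwt Kp mu x ->
  F k (E i (E j x) - E j (E i x)) = E i (E j (F k x)) - E j (E i (F k x)).
Proof.
move=> hij h.
apply: (far_comm premod_linF premod_linE kwt_opp_E kwt_opp_FE (mu := wopp mu)) => //.
by apply: kwt_ext h => k'; rewrite wopp_wopp.
Qed.

Lemma kwt_word lam x w : kwt Kp lam x -> kwt Kp (wword lam w) (foldr F x w).
Proof.
move=> h; elim: w => [|i w IH] /=.
  by apply: kwt_ext h => k; rewrite /wword big_nil subr0.
by apply: kwt_ext (kwt_F i IH) => k; rewrite /wsub /wword big_cons; ring.
Qed.

Lemma kwt_Z mu a x : kwt Kp mu x -> kwt Kp mu (a *: x).
Proof. by move=> h i; rewrite (lin_Z (premod_linKp i)) h !scalerA mulrC. Qed.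

(** Independence of weight spaces. If the first weight differs from [mu] at [k], the operator
    [Kp k - qv ^ wt a k] kills the first term, preserves the weights of the others and multiplies
    [y] by a nonzero scalar, so induction applies. *)
Lemma kwt_sum_weight (I : eqType) (s : seq I) (wt : I -> weight) (z : I -> V) mu y :
  (forall i, i \in s -> kwt Kp (wt i) (z i)) ->
  kwt Kp mu y -> y = \sum_(i <- s) z i -> y != 0 ->
  exists2 i, i \in s & wt i =1 mu.
Proof.
elim: s z y => [|a s IH] z y hz hy; first by rewrite big_nil => ->; rewrite eqxx.
move=> ey y0.
case: (pselect (wt a =1 mu)) => [e|ne]; first by exists a; rewrite ?inE ?eqxx.
have [k hk] : exists k, wt a k <> mu k.
  by apply: contra_notP ne => h k; apply: contrapT => hk; apply: h; exists k.
pose f u := Kp k u - qv ^ wt a k *: u.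
have lf : linear f.
  move=> c u u'; rewrite /f premod_linKp !scalerDr scalerN opprD addrACA.
  by rewrite !scalerA [_ * c]mulrC.
pose g : {linear V -> V} := HB.pack f (GRing.isLinear.Build _ _ _ _ f lf).
have [||||i hi e] := IH (fun i => f (z i)) ((qv ^ mu k - qv ^ wt a k) *: y).
- move=> i hi; have h : kwt Kp (wt i) (z i) by apply: hz; rewrite inE hi orbT.
  by rewrite /f h -scalerBl; apply: kwt_Z.
- exact: kwt_Z.
- transitivity (g y); first by rewrite /= /f hy -scalerBl.
  rewrite ey big_cons linearD linear_sum /= {1}/f hz ?inE ?eqxx //.
  by rewrite subrr add0r.
- rewrite scaler_eq0 negb_or y0 andbT subr_eq0.
  by apply/eqP => /qv_exprz_inj e; apply: hk.
by exists i; rewrite // inE hi orbT.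
Qed.

Lemma Fspan0 x : Fspan F x 0.
Proof. by exists [::]; rewrite big_nil. Qed.

Lemma FspanD x y z : Fspan F x y -> Fspan F x z -> Fspan F x (y + z).
Proof. by move=> [s ->] [t ->]; exists (s ++ t); rewrite big_cat. Qed.

Lemma FspanZ x a y : Fspan F x y -> Fspan F x (a *: y).
Proof.
move=> [s ->]; exists [seq (a * p.1, p.2) | p <- s].
by rewrite big_map scaler_sumr; apply: eq_bigr => p _; rewrite scalerA.
Qed.

Lemma Fspan_word x w : Fspan F x (foldr F x w).
Proof. by exists [:: (1, w)]; rewrite big_seq1 scale1r. Qed.

Lemma Fspan_lin x (f : V -> V) : linear f ->
  (forall w, Fspan F x (f (foldr F x w))) -> forall y, Fspan F x y -> Fspan F x (f y).
Proof.
move=> lf h _ [s ->]; elim: s => [|p s IH].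
  by rewrite big_nil (lin_0 lf); apply: Fspan0.
by rewrite big_cons (lin_D lf) (lin_Z lf); apply: FspanD IH; apply: FspanZ.
Qed.

Lemma FspanF x i y : Fspan F x y -> Fspan F x (F i y).
Proof. by apply: Fspan_lin (premod_linF i) _ y => w; apply: (Fspan_word x (i :: w)). Qed.

Section HighestWeight.
Context (lam : weight) (x : V).
Hypotheses (hx : kwt Kp lam x) (Ex : forall i, E i x = 0).

Lemma FspanKp i y : Fspan F x y -> Fspan F x (Kp i y).
Proof.
apply: Fspan_lin (premod_linKp i) _ y => w.
by rewrite (kwt_word w hx); apply/FspanZ/Fspan_word.
Qed.

Lemma FspanKm i y : Fspan F x y -> Fspan F x (Km i y).
Proof.
apply: Fspan_lin (premod_linKm i) _ y => w.
by rewrite (kwt_Km _ (kwt_word w hx)); apply/FspanZ/Fspan_word.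
Qed.

(** Commuting [E i] past the first letter leaves a shorter word times a scalar, and at the end [E i]
    kills [x]. Hence the span of the [F]-words is already the whole submodule generated by [x]. *)
Lemma FspanE i y : Fspan F x y -> Fspan F x (E i y).
Proof.
apply: Fspan_lin (premod_linE i) _ y; elim=> [|j w IH] /=.
  by rewrite Ex; apply: Fspan0.
rewrite (kwt_EF i j (kwt_word w hx)); apply: FspanD; first exact: FspanF.
by apply/FspanZ/Fspan_word.
Qed.

Lemma Fspan_weight mu y : Fspan F x y -> kwt Kp mu y -> y != 0 ->
  exists w, wword lam w =1 mu.
Proof.
move=> [s ey] hy y0.
have [|p _ e] := kwt_sum_weight (wt := fun p => wword lam p.2) _ hy ey y0.
  by move=> p _; apply/kwt_Z/kwt_word.
by exists p.2.
Qed.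

Lemma Fspan_weight_decomp y : Fspan F x y -> exists c : Qv,
  exists s : seq (Qv * seq int), all (fun p => p.2 != [::]) s /\
    y - c *: x = \sum_(p <- s) p.1 *: foldr F x p.2.
Proof.
move=> [s ->]; exists (\sum_(p <- s | p.2 == [::]) p.1), [seq p <- s | p.2 != [::]].
split; first exact: filter_all.
rewrite big_filter (bigID (fun p => p.2 == [::])) /= scaler_suml addrAC.
rewrite (eq_bigr (fun p => p.1 *: x)); last by move=> p /eqP ->.
by rewrite subrr add0r.
Qed.

(** Once the empty word is split off, the remainder has weight [lam] but is a combination of
    nonempty words, whose weights differ from [lam] by independence of the simple roots; so it is
    zero. *)
Lemma Fspan_top y : Fspan F x y -> kwt Kp lam y -> exists c : Qv, y = c *: x.
Proof.
move=> /Fspan_weight_decomp [c [s [/allP hs e]]] hy; exists c.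
apply/eqP; rewrite -subr_eq0; apply/negPn/negP => y0.
have hy' : kwt Kp lam (y - c *: x).
  move=> i; rewrite (lin_B (premod_linKp i)) hy (kwt_Z c hx) -scalerBr //.
have [|p /hs hp e'] := kwt_sum_weight (wt := fun p => wword lam p.2) _ hy' e y0.
  by move=> p _; apply/kwt_Z/kwt_word.
have : perm_eq p.2 [::].
  apply: sum_alpha_perm => k; have := e' k; rewrite /wword big_nil => /eqP.
  by rewrite subr_eq addrC -subr_eq subrr => /eqP.
by move/perm_size/size0nil => e0; rewrite e0 eqxx in hp.
Qed.
End HighestWeight.
End Premodule.

(** * Uniqueness and the categories *)

Lemma Fspan_submod (M : Umod) lam x : in_wtsp lam x -> (forall i, uE M i x = 0) ->
  submod (Fspan (uF M) x).
Proof.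
move=> hx Ex; have pm := Umod_premod M; split.
- exact: Fspan0.
- exact: FspanD.
- exact: FspanZ.
move=> i y hy; split.
- exact: (FspanE pm hx Ex).
- exact: (FspanF pm).
- exact: (FspanKp pm hx).
- exact: (FspanKm pm hx).
Qed.

Lemma Verma_quotient_Fspan (M : Umod) lam x :
  in_wtsp lam x -> (forall i, uE M i x = 0) -> generates x ->
  forall y, Fspan (uF M) x y.
Proof.
move=> hx Ex gx; apply: gx (Fspan_submod hx Ex) _.
exact: (Fspan_word (uF M) x [::]).
Qed.

Lemma generates_irreducible (M : Umod) (x : M) : irreducible M -> x != 0 -> generates x.
Proof.
move=> [_ irr] x0 P hP Px; have [h|//] := irr P hP.
by move: x0; rewrite (h x Px) eqxx.
Qed.

Lemma generator_neq0 (M : Umod) (x : M) : irreducible M -> generates x -> x != 0.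
Proof.
move=> [[y y0] _] gx; apply: contra_neq y0 => x0.
apply: (gx (fun z => z = 0)) => //; have pm := Umod_premod M.
split => //.
- by move=> u u' -> ->; rewrite addr0.
- by move=> a u ->; rewrite scaler0.
move=> i u ->.
by rewrite (lin_0 (premod_linE pm i)) (lin_0 (premod_linF pm i))
  (lin_0 (premod_linKp pm i)) (lin_0 (premod_linKm pm i)).
Qed.

Definition pair_op (V W : Type) (f : int -> V -> V) (g : int -> W -> W) :
  int -> V * W -> V * W := fun i p => (f i p.1, g i p.2).

Lemma pair_op_linear (V W : lmodType Qv) (f : int -> V -> V) (g : int -> W -> W) i :
  linear (f i) -> linear (g i) -> linear (pair_op f g i).
Proof. by move=> hf hg a [x y] [x' y']; rewrite /pair_op /= hf hg. Qed.

Lemma pair_premod (V W : lmodType Qv) (E F Kp Km : int -> V -> V)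
    (E' F' Kp' Km' : int -> W -> W) :
  is_premod E F Kp Km -> is_premod E' F' Kp' Km' ->
  is_premod (pair_op E E') (pair_op F F') (pair_op Kp Kp') (pair_op Km Km').
Proof.
move=> [lin KK KKm KEF EF] [lin' KK' KKm' KEF' EF']; split.
- move=> i; have [? ? ? ?] := lin i; have [? ? ? ?] := lin' i.
  by split; apply: pair_op_linear.
- by move=> i j [x y]; rewrite /pair_op /= KK KK'.
- move=> i [x y]; rewrite /pair_op /=.
  by have [-> ->] := KKm i x; have [-> ->] := KKm' i y.
- move=> i j [x y]; have [e1 e2] := KEF i j x; have [e3 e4] := KEF' i j y.
  by rewrite /pair_op /= e1 e2 e3 e4.
move=> i j [x y]; have := EF i j x; have := EF' i j y; rewrite /pair_op /=.
by case: eqP => _ e e'; apply/pair_equal_spec; split.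
Qed.

Section Uniqueness.
Context (lam : weight) (M N : Umod) (x : M) (y : N).
Hypotheses (irrM : irreducible M) (irrN : irreducible N).
Hypotheses (hx : in_wtsp lam x) (Ex : forall i, uE M i x = 0) (gx : generates x).
Hypotheses (hy : in_wtsp lam y) (Ey : forall i, uE N i y = 0) (gy : generates y).

(* The submodule of [M * N] generated by [(x, y)]; it is the graph of an isomorphism. *)
Let G (m : M) (n : N) : Prop := Fspan (pair_op (uF M) (uF N)) (x, y) (m, n).

Let pm := pair_premod (Umod_premod M) (Umod_premod N).

Let hxy : kwt (pair_op (uK M) (uK N)) lam (x, y).
Proof. by move=> i; rewrite /pair_op /= hx hy. Qed.

Let Exy i : pair_op (uE M) (uE N) i (x, y) = 0.
Proof. by rewrite /pair_op /= Ex Ey. Qed.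

Let Gxy : G x y. Proof. exact: (Fspan_word _ (x, y) [::]). Qed.
Let G0 : G 0 0. Proof. exact: Fspan0. Qed.
Let GD m n m' n' : G m n -> G m' n' -> G (m + m') (n + n').
Proof. by move=> h h'; have := FspanD h h'. Qed.
Let GZ a m n : G m n -> G (a *: m) (a *: n).
Proof. by move=> h; have := FspanZ a h. Qed.
Let Gop i m n : G m n -> [/\ G (uE M i m) (uE N i n), G (uF M i m) (uF N i n),
  G (uK M i m) (uK N i n) & G (uKi M i m) (uKi N i n)].
Proof.
move=> h; split.
- exact: (FspanE pm hxy Exy i h).
- exact: (FspanF pm i h).
- exact: (FspanKp pm hxy i h).
- exact: (FspanKm pm hxy i h).
Qed.

(** The projection of [G] to [M] is a submodule containing the generator [x]. *)
Let G_total m : exists n, G m n.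
Proof.
apply: (gx (P := fun m => exists n, G m n)); last by exists y.
split; first by exists 0.
- by move=> u u' [n h] [n' h']; exists (n + n'); apply: GD.
- by move=> a u [n h]; exists (a *: n); apply: GZ.
move=> i u [n /(Gop i) [h1 h2 h3 h4]].
by split; eexists; eassumption.
Qed.

Let G_onto n : exists m, G m n.
Proof.
apply: (gy (P := fun n => exists m, G m n)); last by exists x.
split; first by exists 0.
- by move=> u u' [m h] [m' h']; exists (m + m'); apply: GD.
- by move=> a u [m h]; exists (a *: m); apply: GZ.
move=> i u [m /(Gop i) [h1 h2 h3 h4]].
by split; eexists; eassumption.
Qed.

Let G_top m n : in_wtsp lam m -> in_wtsp lam n -> G m n ->
  exists c : Qv, m = c *: x /\ n = c *: y.
Proof.
move=> hm hn h; have hmn : kwt (pair_op (uK M) (uK N)) lam (m, n).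
  by move=> i; rewrite /pair_op /= hm hn.
by have [c [-> ->]] := Fspan_top pm hxy h hmn; exists c.
Qed.

Let in_wtsp0 (L : Umod) : in_wtsp lam (0 : L).
Proof. by move=> i; rewrite (lin_0 (premod_linKp (Umod_premod L) i)) scaler0. Qed.

(** The [n] with [G 0 n] form a submodule of [N]. Were it all of [N], the pair [(0, y)] would lie on
    the line through [(x, y)], which is impossible as [x] and [y] are nonzero. *)
Let G_inj_l n : G 0 n -> n = 0.
Proof.
have [|h|h] := (proj2 irrN) (fun n => G 0 n); [|exact: h|].
- split => //.
  + by move=> u u' h h'; rewrite -[0]addr0; apply: GD.
  + by move=> a u h; rewrite -(scaler0 _ a); apply: GZ.
  move=> i u /(Gop i); have pM := Umod_premod M.
  by rewrite (lin_0 (premod_linE pM i)) (lin_0 (premod_linF pM i))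
    (lin_0 (premod_linKp pM i)) (lin_0 (premod_linKm pM i)).
have [c [/eqP e1 /eqP e2]] := G_top (in_wtsp0 M) hy (h y).
move: e1; rewrite eq_sym scaler_eq0 (negbTE (generator_neq0 irrM gx)) orbF => /eqP c0.
by move: e2; rewrite c0 scale0r (negbTE (generator_neq0 irrN gy)).
Qed.

Let G_inj_r m : G m 0 -> m = 0.
Proof.
have [|h|h] := (proj2 irrM) (fun m => G m 0); [|exact: h|].
- split => //.
  + by move=> u u' h h'; rewrite -[0]addr0; apply: GD.
  + by move=> a u h; rewrite -(scaler0 _ a); apply: GZ.
  move=> i u /(Gop i); have pN := Umod_premod N.
  by rewrite (lin_0 (premod_linE pN i)) (lin_0 (premod_linF pN i))
    (lin_0 (premod_linKp pN i)) (lin_0 (premod_linKm pN i)).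
have [c [/eqP e1 /eqP e2]] := G_top hx (in_wtsp0 N) (h x).
move: e2; rewrite eq_sym scaler_eq0 (negbTE (generator_neq0 irrN gy)) orbF => /eqP c0.
by move: e1; rewrite c0 scale0r (negbTE (generator_neq0 irrM gx)).
Qed.

Let GN m n : G m n -> G (- m) (- n).
Proof. by move=> /(GZ (-1)); rewrite !scaleN1r. Qed.

Lemma highest_weight_iso : Umod_iso M N.
Proof.
have [f hf] := choice G_total; have [g hg] := choice G_onto.
have uniq_r m n n' : G m n -> G m n' -> n = n'.
  move=> h /GN h'; apply/eqP; rewrite -subr_eq0; apply/eqP/G_inj_l.
  by rewrite -(subrr m); apply: GD.
have uniq_l m m' n : G m n -> G m' n -> m = m'.
  move=> h /GN h'; apply/eqP; rewrite -subr_eq0; apply/eqP/G_inj_r.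
  by rewrite -(subrr n); apply: GD.
exists f; split.
- by move=> a u v; apply: uniq_r (hf _) _; apply: GD (hf v); apply: GZ.
- by exists g => u; [apply: uniq_l (hg _) (hf _) | apply: uniq_r (hf _) (hg _)].
by move=> i u; have [h1 h2 h3 h4] := Gop i (hf u); split; apply: uniq_r (hf _) _.
Qed.
End Uniqueness.

Lemma isL_iso lam (M N : Umod) : isL lam M -> isL lam N -> Umod_iso M N.
Proof.
move=> [iM [x [hx Ex gx]]] [iN [y [hy Ey gy]]].
exact: (highest_weight_iso iM iN hx Ex gx hy Ey gy).
Qed.

(** Transporting each highest weight vector to the other module shows that each weight is below the
    other. The two differences are sums of simple roots with total zero, so both sums are empty. *)
Lemma isL_weight_inj lam mu (M N : Umod) :
  isL lam M -> isL mu N -> Umod_iso M N -> lam =1 mu.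
Proof.
move=> [iM [x [hx Ex gx]]] [iN [y [hy Ey gy]]] [f [lf [g fK gK] fop]].
have pM := Umod_premod M; have pN := Umod_premod N.
have inj := can_inj fK.
have fx0 : f x != 0.
  by rewrite -(lin_0 lf) (inj_eq inj) (generator_neq0 iM gx).
have gy0 : g y != 0.
  by rewrite -(inj_eq inj) gK (lin_0 lf) (generator_neq0 iN gy).
have hfx : in_wtsp lam (f x).
  by move=> i; have [_ _ <- _] := fop i x; rewrite hx (lin_Z lf).
have hgy : in_wtsp mu (g y).
  by move=> i; apply: inj; have [_ _ -> _] := fop i (g y); rewrite gK hy (lin_Z lf) gK.
have [w hw] := Fspan_weight pN hy (Verma_quotient_Fspan hy Ey gy (f x)) hfx fx0.
have [u hu] := Fspan_weight pM hx (Verma_quotient_Fspan hx Ex gx (g y)) hgy gy0.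
have : perm_eq (w ++ u) [::].
  apply: sum_alpha_perm => k; rewrite big_cat big_nil /=.
  have := hw k; have := hu k; rewrite /wword => <-.
  set a := \sum_(_ <- w) _; set b := \sum_(_ <- u) _ => h.
  by apply: (addrI (lam k)); rewrite addr0 -{1}h; ring.
move/perm_size/eqP; rewrite size_cat addn_eq0 => /andP [/nilP w0 _] k.
by rewrite -hw /wword w0 big_nil subr0.
Qed.

(** * Local nilpotence of the [E_i], and membership in C^hi and O *)

Definition nilpotent_on (M : Umod) (n0 : nat) (x : M) : Prop :=
  forall s : seq int, (n0 <= size s)%N -> foldr (fun i y => uE M i y) x s = 0.

(** Apply operators [E_i] as long as one of them gives a nonzero vector; nilpotence bounds the
    number of steps. Only stability of [P] under the [E_i] is asked, so that [P] may be a submodule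
    or the set of weight vectors. *)
Lemma exists_E_invariant (M : Umod) (P : M -> Prop) (n0 : nat) (y : M) :
  (forall i z, P z -> P (uE M i z)) -> P y -> y != 0 -> nilpotent_on n0 y ->
  exists z, [/\ P z, z != 0 & forall i, uE M i z = 0].
Proof.
move=> PE; elim: n0 y => [|n IH] y Py y0 hn.
  by move: y0; rewrite (hn [::] isT : y = 0) eqxx.
case: (pselect (forall i, uE M i y = 0)) => [Ey|nE]; first by exists y.
have [i hi] : exists i, uE M i y != 0.
  by apply: contra_notP nE => h i; apply/eqP/negPn/negP => hi; apply: h; exists i.
apply: (IH (uE M i y)) => // [|t ht]; first exact: PE.
rewrite -(foldr_rcons (fun i y => uE M i y)).
by apply: hn; rewrite size_rcons.
Qed.

(** Some weight component of a nonzero vector is nonzero; raising it with the [E_i] ends at a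
    highest weight vector, which generates by irreducibility. *)
Lemma in_Chi_isL (M : Umod) : in_Chi M -> irreducible M -> exists lam, isL lam M.
Proof.
move=> [wM nM] iM; have [[z z0] _] := iM; have pm := Umod_premod M.
have [s [lams [hs ez]]] := wM z.
have [k [hk k0]] : exists k, (k < size s)%N /\ s`_k != 0.
  apply: contra_neqP z0 => h; rewrite ez big_seq big1 // => u hu.
  apply/eqP/negPn/negP => u0; apply: h; exists (index u s).
  by rewrite index_mem hu nth_index.
have [n0 hn] := nM s`_k.
have [||x [[mu hx] x0 Ex]] :=
  @exists_E_invariant M (fun y => exists mu, in_wtsp mu y) _ _ _ _ k0 hn.
- by move=> i y [mu hy]; exists (wadd mu (alpha i)); apply: (kwt_E pm).
- by exists (lams k); apply: hs.
by exists mu; split=> //; exists x; split=> //; exact: generates_irreducible.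
Qed.

(** All decompositions of [lam - mu] into simple roots have the same length; if there is none, the
    bound 0 holds vacuously. *)
Lemma le_wt_size_bound (mu lam : weight) : exists B : nat, forall s : seq int,
  (forall k, lam k - mu k = \sum_(i <- s) alpha i k) -> (size s <= B)%N.
Proof.
case: (pselect (le_wt mu lam)) => [[t ht]|n]; last first.
  by exists 0%N => s hs; case: n; exists s.
exists (size t) => s hs; rewrite (@perm_size _ s t) //.
by apply: sum_alpha_perm => k; rewrite -hs -ht.
Qed.

(** An [E]-word raises the weight by as many simple roots as it has letters, and the weights of [M]
    lie below finitely many [lams k]. So long words kill each weight vector, hence each finite sum
    of them. *)
Lemma in_O_in_Chi (M : Umod) : in_O M -> in_Chi M.
Proof.
move=> [wM _ [n [lams hlams]]]; split => // x; have pm := Umod_premod M.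
have linE s : linear (fun x => foldr (fun i y => uE M i y) x s).
  move=> a u v; elim: s => [|i s IH] //=; by rewrite IH (premod_linE pm).
have wtE mu (y : M) s : in_wtsp mu y ->
    in_wtsp (fun k => mu k + \sum_(i <- s) alpha i k) (foldr (fun i y => uE M i y) y s).
  move=> hy; elim: s => [|i s IH] /=.
    by apply: (kwt_ext _ hy) => k; rewrite big_nil addr0.
  by apply: (kwt_ext _ (kwt_E pm i IH)) => k; rewrite /wadd big_cons; ring.
have nil mu (y : M) : in_wtsp mu y -> exists n0, nilpotent_on n0 y.
  move=> hy.
  have [B hB] : exists B : nat, forall k s, (k < n)%N ->
      (forall i, lams k i - mu i = \sum_(j <- s) alpha j i) -> (size s <= B)%N.
    elim: (n) => [|m [B hB]]; first by exists 0%N.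
    have [B' hB'] := le_wt_size_bound mu (lams m).
    exists (maxn B B') => k s; rewrite ltnS leq_eqVlt => /orP [/eqP -> /hB' h|hk /(hB _ _ hk) h].
      by rewrite leq_max h orbT.
    by rewrite leq_max h.
  (* If the word [s] did not kill [y], the new weight would lie below some [lams k] by a sum over
     some [t], and [s ++ t] would decompose [lams k - mu] with more than [B] roots. *)
  exists B.+1 => s hs; apply/eqP/negPn/negP => h0.
  have [k [hk [t ht]]] := hlams _ (ex_intro _ _ (conj h0 (wtE _ _ s hy))).
  have : (size (s ++ t) <= B)%N.
    apply: (hB k) => // i; rewrite big_cat /= -ht; ring.
  by rewrite size_cat => h; have := leq_trans (leq_trans hs (leq_addr _ _)) h; rewrite ltnn.
have [s [wts [hs ->]]] := wM x; elim: s wts hs => [|y s IH] wts hs.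
  by exists 0%N => t _; rewrite big_nil (lin_0 (linE t)).
have [n1 h1] := nil _ _ (hs 0%N isT).
have [n2 h2] := IH (fun k => wts k.+1) (fun k => hs k.+1).
exists (maxn n1 n2) => t; rewrite geq_max => /andP [t1 t2].
by rewrite big_cons (lin_D (linE t)) h1 // h2 // addr0.
Qed.

Lemma submod_Fspan (M : Umod) (P : M -> Prop) x y :
  submod P -> P x -> Fspan (uF M) x y -> P y.
Proof.
move=> [P0 PD PZ Pop] Px [s ->]; elim: s => [|p s IH]; first by rewrite big_nil.
rewrite big_cons; apply: PD IH; apply: PZ.
by elim: (p.2) => //= i w /(Pop i) [].
Qed.

(** Coefficients are collected at the first occurrence of each index in [W], so that repetitions in
    [W] or [s] do no harm. This yields the shape required by [fin_dim_wtsp]. *)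
Lemma sum_in_list_span (V : lmodType Qv) (I : eqType) (b : I -> V) (W : seq I)
    (s : seq (Qv * I)) : all (fun p => p.2 \in W) s ->
  exists c : seq Qv, \sum_(p <- s) p.1 *: b p.2 = \sum_(k < size [seq b i | i <- W])
    c`_k *: [seq b i | i <- W]`_k.
Proof.
move=> hs; exists (mkseq (fun k => \sum_(p <- s | index p.2 W == k) p.1) (size W)).
rewrite size_map; transitivity (\sum_(k < size W) \sum_(p <- s | index p.2 W == k)
    p.1 *: b p.2); last first.
  apply: eq_bigr => k _; rewrite nth_mkseq ?ltn_ord // scaler_suml.
  rewrite big_seq_cond [RHS]big_seq_cond; apply: eq_bigr => p /andP [hp /eqP <-].
  have pW := allP hs _ hp.
  by rewrite (nth_map p.2) ?index_mem // nth_index.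
rewrite (exchange_big_dep predT) //= big_seq [RHS]big_seq.
apply: eq_bigr => p hp; have pW := allP hs _ hp.
have hi : (index p.2 W < size W)%N by rewrite index_mem.
by rewrite (bigD1 (Ordinal hi)) //= big1 ?addr0 // => k /andP [/eqP e]; rewrite -val_eqE /= e eqxx.
Qed.

(** The [F]-words span [M], and those of a given weight are the permutations of a single word, hence
    finite in number. *)
Lemma Verma_quotient_in_O lam (M : Umod) : Verma_quotient lam M -> in_O M.
Proof.
move=> [x [hx Ex gx]]; have pm := Umod_premod M.
have span := Verma_quotient_Fspan hx Ex gx; split.
- move=> y; have [s ->] := span y.
  exists [seq p.1 *: foldr (uF M) x p.2 | p <- s], (fun k => wword lam (nth (0, [::]) s k).2).
  rewrite big_map size_map; split=> // k hk; rewrite (nth_map (0, [::])) //.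
  exact/(kwt_Z pm)/(kwt_word pm).
- move=> mu; case: (pselect (exists w, wword lam w =1 mu)) => [[w0 hw0]|no]; last first.
    exists [::] => y hy; exists [::]; rewrite big_ord0.
    by apply/eqP/negPn/negP => y0; apply: no; apply: (Fspan_weight pm hx (span y) hy y0).
  exists [seq foldr (uF M) x w | w <- permutations w0] => y hy.
  have [s ey] := span y.
  pose good (p : Qv * seq int) := p.2 \in permutations w0.
  have goodP p : wword lam p.2 =1 mu <-> good p.
    rewrite /good mem_permutations; split=> [h|/permP hp k].
      apply: sum_alpha_perm => k; have := hw0 k; rewrite -h /wword.
      by move/addrI/oppr_inj.
    rewrite -hw0 /wword; congr (_ - _); apply: perm_big.
    by rewrite perm_sym; apply/permP => ?; rewrite hp.
  (* Only the terms of weight [mu] matter: the rest of the sum has weight [mu] yet is a combination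
     of vectors of other weights, so it vanishes. *)
  suff -> : y = \sum_(p <- [seq p <- s | good p]) p.1 *: foldr (uF M) x p.2.
    by apply: (sum_in_list_span (foldr (uF M) x)); apply: filter_all.
  apply/eqP; rewrite -subr_eq0; apply/negPn/negP => d0.
  set d := _ - _ in d0.
  have hg p : good p -> in_wtsp mu (p.1 *: foldr (uF M) x p.2).
    by move=> /goodP h; apply: (kwt_ext h); apply/(kwt_Z pm)/(kwt_word pm).
  have hd : in_wtsp mu d.
    move=> i; rewrite /d (lin_B (premod_linKp pm i)) hy scalerBr; congr (_ - _).
    rewrite big_filter; elim: (s) => [|p t IH].
      by rewrite big_nil (lin_0 (premod_linKp pm i)) scaler0.
    rewrite big_cons; case: ifP => // /hg hp.
    by rewrite (lin_D (premod_linKp pm i)) hp IH scalerDr.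
  have ed : d = \sum_(p <- [seq p <- s | ~~ good p]) p.1 *: foldr (uF M) x p.2.
    by rewrite /d {1}ey (bigID good) /= !big_filter addrAC subrr add0r.
  have [|p] := kwt_sum_weight pm (wt := fun p => wword lam p.2) _ hd ed d0.
    by move=> p _; apply/(kwt_Z pm)/(kwt_word pm).
  by rewrite mem_filter => /andP [/negP ng _] /goodP.
exists 1%N, (fun _ => lam) => mu [y [y0 hy]]; exists 0%N; split=> //.
have [w hw] := Fspan_weight pm hx (span y) hy y0.
by exists w => k; rewrite -hw /wword; ring.
Qed.

(** * Construction of L(lam) *)

Section Submodule.
Context (V : lmodType Qv) (S : V -> Prop).
Hypotheses (S0 : S 0) (SD : forall x y, S x -> S y -> S (x + y)).
Hypothesis SZ : forall (a : Qv) x, S x -> S (a *: x).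

Let inS : {pred V} := fun x => `[< S x >].

Fact inS_submod : submod_closed inS.
Proof.
split=> [|a x y /asboolP hx /asboolP hy]; first exact/asboolP.
by apply/asboolP/SD => //; apply: SZ.
Qed.

HB.instance Definition _ := GRing.isSubmodClosed.Build Qv V inS inS_submod.

Record subspace_of := SubspaceOf { subspace_val : V; _ : subspace_val \in inS }.
HB.instance Definition _ := [isSub for subspace_val].
HB.instance Definition _ := [Choice of subspace_of by <:].
HB.instance Definition _ := [SubChoice_isSubLmodule of subspace_of by <:].

Lemma lmod_of_subspace : exists (W : lmodType Qv) (inc : W -> V),
  [/\ linear inc, injective inc, forall w, S (inc w) & forall x, S x -> exists w, inc w = x].
Proof.
exists subspace_of, val; split.
- exact: linearP.
- exact: val_inj.
- by move=> [u hu]; apply/asboolP.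
- by move=> x hx; have hx' : x \in inS by [apply/asboolP]; exists (SubspaceOf hx').
Qed.
End Submodule.

(** The ambient space is only a premodule; it is enough that the remaining relations hold on [S],
    since every identity is checked after the injection [inc]. *)
Lemma Umod_of_subspace (V : lmodType Qv) (E F Kp Km : int -> V -> V) (S : V -> Prop) :
  is_premod E F Kp Km ->
  S 0 -> (forall x y, S x -> S y -> S (x + y)) -> (forall (a : Qv) x, S x -> S (a *: x)) ->
  (forall i x, S x -> [/\ S (E i x), S (F i x), S (Kp i x) & S (Km i x)]) ->
  (forall i j x, 1 < `|i - j| -> S x ->
     E i (E j x) - E j (E i x) = 0 /\ F i (F j x) - F j (F i x) = 0) ->
  (forall i j x, `|i - j| = 1 -> S x -> serre E i j x = 0 /\ serre F i j x = 0) ->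
  exists (M : Umod) (inc : M -> V),
    [/\ linear inc, injective inc, forall w, S (inc w), forall x, S x -> exists w, inc w = x &
      forall i w, [/\ inc (uE M i w) = E i (inc w), inc (uF M i w) = F i (inc w),
        inc (uK M i w) = Kp i (inc w) & inc (uKi M i w) = Km i (inc w)]].
Proof.
move=> pm S0 SD SZ Sop far adj.
have [W [inc [linc inj incS onto]]] := lmod_of_subspace S0 SD SZ.
have lift (A : int -> V -> V) : (forall i x, S x -> S (A i x)) ->
    exists A' : int -> W -> W, forall i w, inc (A' i w) = A i (inc w).
  move=> hA; have [A' hA'] := choice (fun iw : int * W => onto _ (hA iw.1 _ (incS iw.2))).
  by exists (fun i w => A' (i, w)) => i w; rewrite hA'.
have [E' hE] := lift E (fun i x h => let: And4 h1 _ _ _ := Sop i x h in h1).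
have [F' hF] := lift F (fun i x h => let: And4 _ h1 _ _ := Sop i x h in h1).
have [Kp' hKp] := lift Kp (fun i x h => let: And4 _ _ h1 _ := Sop i x h in h1).
have [Km' hKm] := lift Km (fun i x h => let: And4 _ _ _ h1 := Sop i x h in h1).
have [lin KK KKm KEF EF] := pm.
have lin' (A : int -> V -> V) (A' : int -> W -> W) i :
    (forall i w, inc (A' i w) = A i (inc w)) -> linear (A i) -> linear (A' i).
  by move=> hA lA a u v; apply: inj; rewrite hA !linc lA !hA.
have ax : is_Umod E' F' Kp' Km'.
  do ![split].
  - by have [h _ _ _] := lin i; apply: lin' hE h.
  - by have [_ h _ _] := lin i; apply: lin' hF h.
  - by have [_ _ h _] := lin i; apply: lin' hKp h.
  - by have [_ _ _ h] := lin i; apply: lin' hKm h.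
  - by move=> i j x; apply: inj; rewrite !hKp KK.
  - by apply: inj; rewrite hKp hKm; have [-> _] := KKm i (inc x).
  - by apply: inj; rewrite hKm hKp; have [_ ->] := KKm i (inc x).
  - apply: inj; rewrite (lin_Z linc) hKp !hE hKp; have [-> _] := KEF i j (inc x).
    by rewrite /alpha.
  - apply: inj; rewrite (lin_Z linc) hKp !hF hKp; have [_ ->] := KEF i j (inc x).
    by rewrite /alpha opprB.
  - apply/eqP; rewrite -subr_eq0; apply/eqP/inj.
    by rewrite (lin_B linc) (lin_0 linc) !hE; have [] := far _ _ _ H (incS x).
  - apply/eqP; rewrite -subr_eq0; apply/eqP/inj.
    by rewrite (lin_B linc) (lin_0 linc) !hF; have [] := far _ _ _ H (incS x).
  - move=> i j x; apply: inj; rewrite (lin_B linc) hE hF hF hE EF.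
    case: eqP => _; last by rewrite (lin_0 linc).
    by rewrite (lin_Z linc) (lin_B linc) hKp !hKm hKp.
  - apply: inj; rewrite (lin_D linc) (lin_B linc) (lin_Z linc) (lin_0 linc) !hE.
    by have [] := adj _ _ _ H (incS x).
  - apply: inj; rewrite (lin_D linc) (lin_B linc) (lin_Z linc) (lin_0 linc) !hF.
    by have [] := adj _ _ _ H (incS x).
by exists (Build_Umod ax), inc; split=> // i w; split => /=.
Qed.

(* The dual of the Verma module of the algebra without Serre relations, whose basis is the
   set of words [w] in the [F_i]: the operators are the transposes of the actions of
   [F_i], [E_i] and [K_i] on that basis. *)
Section DualVerma.
Context (lam : weight).
Local Notation V := (seq int -> Qv^o).

Definition dualE (i : int) (f : V) : V := fun w => f (i :: w).

(** Evaluates [f] at [E_i] applied to the word: [E_i] kills the empty word, and [E_i F_j] equals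
    [F_j E_i] plus, for [i = j], a quantum integer. Precomposition of [f] with [F_j] is
    [dualE j f]. *)
Fixpoint dualF_rec (i : int) (w : seq int) (f : V) : Qv :=
  if w is j :: w' then
    dualF_rec i w' (dualE j f) + (if j == i then qint (coroot j (wword lam w')) else 0) * f w'
  else 0.
Definition dualF (i : int) (f : V) : V := fun w => dualF_rec i w f.

Definition dualK (i : int) (f : V) : V := fun w => qv ^ wword lam w i * f w.
Definition dualKi (i : int) (f : V) : V := fun w => qv ^ (- wword lam w i) * f w.

(** Holds by computation: [dualE i] evaluates at [i :: w], where this is the recursive clause of
    [dualF_rec]. *)
Lemma dual_EF i j f w : dualE i (dualF j f) w =
  dualF j (dualE i f) w + (if i == j then qint (coroot i (wword lam w)) else 0) * f w.
Proof. by []. Qed.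

Lemma wword_cons j w i : wword lam (j :: w) i = wword lam w i - alpha j i.
Proof. by rewrite /wword big_cons; ring. Qed.

Lemma dual_linE i : linear (dualE i). Proof. by []. Qed.

Lemma dual_linF i : linear (dualF i).
Proof.
move=> a f g; apply: funext => w.
rewrite (_ : (a *: dualF i f + dualF i g) w = a * dualF i f w + dualF i g w) //.
elim: w f g => [|j w IH] f g; first by rewrite /dualF /= mulr0 addr0.
rewrite -[LHS]/(dualE j (dualF i _) w) -[dualF i f _]/(dualE j (dualF i _) w).
rewrite -[dualF i g _]/(dualE j (dualF i _) w) !dual_EF dual_linE IH.
rewrite (_ : (a *: f + g) w = a * f w + g w) //; ring.
Qed.

Lemma dual_linK i : linear (dualK i).
Proof.
move=> a f g; apply: funext => w; rewrite /dualK.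
transitivity (qv ^ wword lam w i * (a * f w + g w)) => //.
rewrite mulrDr mulrCA //.
Qed.

Lemma dual_linKi i : linear (dualKi i).
Proof.
move=> a f g; apply: funext => w; rewrite /dualKi.
transitivity (qv ^ (- wword lam w i) * (a * f w + g w)) => //.
rewrite mulrDr mulrCA //.
Qed.

Lemma dual_KE i j f : dualK i (dualE j f) = qv ^ alpha j i *: dualE j (dualK i f).
Proof.
apply: funext => w; rewrite /dualK /dualE.
transitivity (qv ^ alpha j i * (qv ^ wword lam (j :: w) i * f (j :: w))) => //.
by rewrite mulrA -expfzDr ?qv_neq0 // wword_cons addrCA subrr addr0.
Qed.

(** Peeling off the first letter [k] replaces [f] by [dualE k f], to which induction applies; the
    correction term occurs only for [k = j], where the two scalars agree. *)
Lemma dual_KF i j f : dualK i (dualF j f) = qv ^ (- alpha j i) *: dualF j (dualK i f).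
Proof.
apply: funext => w.
suff : dualK i (dualF j f) w = qv ^ (- alpha j i) * dualF j (dualK i f) w by [].
elim: w f => [|k w IH] f; first by rewrite /dualK /dualF /= !mulr0.
have -> : dualK i (dualF j f) (k :: w) = qv ^ (- alpha k i) *
    (dualK i (dualF j (dualE k f)) w +
     qv ^ wword lam w i * ((if k == j then qint (coroot k (wword lam w)) else 0) * f w)).
  rewrite /dualK -mulrDr -dual_EF /dualE mulrA wword_cons.
  by rewrite -expfzDr ?qv_neq0 // [- _ + _]addrC.
have -> : dualF j (dualK i f) (k :: w) = qv ^ (- alpha k i) * dualF j (dualK i (dualE k f)) w
   + (if k == j then qint (coroot k (wword lam w)) else 0) * dualK i f w.
  rewrite -[LHS]/(dualE k (dualF j _) w) dual_EF; congr (_ + _).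
  have -> : dualE k (dualK i f) = qv ^ (- alpha k i) *: dualK i (dualE k f).
    by rewrite dual_KE scalerA -expfzDr ?qv_neq0 // addNr expr0z scale1r.
  by rewrite (lin_Z (dual_linF j)).
rewrite IH /dualK; case: eqP => [->|_]; ring.
Qed.

Lemma dual_premod : is_premod dualE dualF dualK dualKi.
Proof.
split.
- by move=> i; split; [apply: dual_linE | apply: dual_linF | apply: dual_linK | apply: dual_linKi].
- by move=> i j f; apply: funext => w; rewrite /dualK mulrCA.
- move=> i f; split; apply: funext => w; rewrite /dualK /dualKi mulrA -expfzDr ?qv_neq0 //.
  + by rewrite subrr expr0z mul1r.
  + by rewrite addNr expr0z mul1r.
- by move=> i j f; rewrite dual_KE dual_KF.
move=> i j f; apply: funext => w.
transitivity (dualE i (dualF j f) w - dualF j (dualE i f) w) => //.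
rewrite dual_EF addrAC subrr add0r; case: eqP => _; last by rewrite mul0r.
transitivity ((qv - qv^-1)^-1 * (qv ^ wword lam w i * (qv ^ (- wword lam w (i + 1)) * f w)
  - qv ^ (- wword lam w i) * (qv ^ wword lam w (i + 1) * f w))) => //.
rewrite /qint /coroot; move: (wword lam w i) (wword lam w (i + 1)) (f w) => a b c.
rewrite opprD opprK !(expfzDr _ _ qv_neq0); ring.
Qed.

(** * The highest weight vector of the dual, and the Serre relations on the submodule it
    generates *)

Definition dual_hw : V := fun w => (w == [::])%:R.

Lemma dual_hw_kwt : kwt dualK lam dual_hw.
Proof.
move=> i; apply: funext => w.
transitivity (qv ^ wword lam w i * dual_hw w) => //.
transitivity (qv ^ lam i * dual_hw w) => //; rewrite /dual_hw.
by case: eqP => [->|_]; rewrite ?mulr0 // /wword big_nil subr0.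
Qed.

Lemma dual_hw_E i : dualE i dual_hw = 0. Proof. exact: funext. Qed.

(* Since [dualE k f w = f (k :: w)], an operator commuting with all the [dualE k] is
   determined by its values at the empty word. *)
Lemma dual_eq0 (C : V -> Prop) (D : V -> V) :
  (forall f, C f -> D f [::] = 0) ->
  (forall k f, C f -> C (dualE k f) /\ dualE k (D f) = D (dualE k f)) ->
  forall f, C f -> D f = 0.
Proof.
move=> h0 hE f hf; apply: funext => w; rewrite -[RHS]/(0 : Qv).
elim: w f hf => [|k w IH] f hf; first exact: h0.
have [hk e] := hE k f hf.
by rewrite -[LHS]/(dualE k (D f) w) e IH.
Qed.

Definition is_kwt (f : V) : Prop := exists mu, kwt dualK mu f.

Lemma is_kwt_E k f : is_kwt f -> is_kwt (dualE k f).
Proof. by move=> [mu h]; exists (wadd mu (alpha k)); apply: (kwt_E dual_premod). Qed.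

Lemma is_kwt_word w : is_kwt (foldr dualF dual_hw w).
Proof. by exists (wword lam w); apply: (kwt_word dual_premod); apply: dual_hw_kwt. Qed.

(** The Serre element commutes with every [dualE k] on weight vectors and takes the value 0 at the
    empty word, because every [dualF i f] does. *)
Lemma dual_serreF i j f : `|i - j| = 1 -> is_kwt f -> serre dualF i j f = 0.
Proof.
move=> hij; apply: dual_eq0 => [g _|k g hg].
  by rewrite -[LHS]/(0 - (qv + qv^-1) * 0 + 0) mulr0 subr0 addr0.
split; first exact: is_kwt_E.
by have [mu h] := hg; apply: (serre_F_E dual_premod k hij h).
Qed.

Lemma dual_farF i j f : 1 < `|i - j| -> is_kwt f ->
  dualF i (dualF j f) - dualF j (dualF i f) = 0.
Proof.
move=> hij; apply: (dual_eq0 (D := fun f => dualF i (dualF j f) - dualF j (dualF i f))).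
  by move=> g _; rewrite -[LHS]/(0 - 0 : Qv) subr0.
move=> k g hg; split; first exact: is_kwt_E.
by have [mu h] := hg; apply: (far_F_E dual_premod k hij h).
Qed.

(** The operators [dualE] are free on the whole dual, so the argument here is confined to [F]-words:
    the Serre element kills [dual_hw] and commutes with each [dualF k]. *)
Lemma dual_serreE i j w : `|i - j| = 1 -> serre dualE i j (foldr dualF dual_hw w) = 0.
Proof.
move=> hij; have pm := dual_premod; elim: w => [|k w IH] /=.
  rewrite /serre !dual_hw_E !(lin_0 (dual_linE _)) scaler0 subr0 addr0 //.
have [mu h] := is_kwt_word w.
by rewrite -(serre_E_F pm k hij h) IH (lin_0 (dual_linF k)).
Qed.

Lemma dual_farE i j w : 1 < `|i - j| -> let x := foldr dualF dual_hw w in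
  dualE i (dualE j x) - dualE j (dualE i x) = 0.
Proof.
move=> hij; have pm := dual_premod; elim: w => [|k w IH] /=.
  by rewrite !dual_hw_E !(lin_0 (dual_linE _)) subr0.
have [mu h] := is_kwt_word w.
by rewrite -(far_E_F pm k hij h) IH (lin_0 (dual_linF k)).
Qed.

End DualVerma.

Lemma exists_isL lam : exists M : Umod, isL lam M.
Proof.
pose S := Fspan (dualF lam) (dual_hw : seq int -> Qv^o).
have pm := dual_premod lam; have hwt := dual_hw_kwt lam.
have vanish (D : (seq int -> Qv^o) -> seq int -> Qv^o) : linear D ->
    (forall w, D (foldr (dualF lam) dual_hw w) = 0) -> forall f, S f -> D f = 0.
  move=> lD h _ [s ->]; elim: s => [|p s IH]; first by rewrite big_nil (lin_0 lD).
  by rewrite big_cons (lin_D lD) (lin_Z lD) h IH scaler0 addr0.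
have lin_serre (B : int -> (seq int -> Qv^o) -> seq int -> Qv^o) i j :
    (forall i, linear (B i)) -> linear (serre B i j).
  move=> lB a f g; rewrite /serre !lB !(scalerDr, scalerA) opprD.
  rewrite scalerN scalerA [a * _]mulrC.
  by rewrite !addrA [LHS](ACl (1*3*5*2*4*6))%AC.
have lin_far (B : int -> (seq int -> Qv^o) -> seq int -> Qv^o) i j :
    (forall i, linear (B i)) -> linear (fun f => B i (B j f) - B j (B i f)).
  by move=> lB a f g; rewrite !lB scalerBr opprD addrACA.
have [||||||M [inc [linc inj incS onto op]]] := @Umod_of_subspace _ _ _ _ _ S pm.
- exact: Fspan0.
- exact: FspanD.
- exact: FspanZ.
- move=> i f hf; split.
  + exact: (FspanE pm hwt dual_hw_E).
  + exact: (FspanF pm).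
  + exact: (FspanKp pm hwt).
  + exact: (FspanKm pm hwt).
- move=> i j f hij hf; split.
  + by apply: (vanish _ (lin_far _ i j dual_linE)) => // w; apply: dual_farE.
  + apply: (vanish _ (lin_far _ i j (dual_linF lam))) => // w.
    by apply: dual_farF => //; apply: is_kwt_word.
- move=> i j f hij hf; split.
  + by apply: (vanish _ (lin_serre _ i j dual_linE)) => // w; apply: dual_serreE.
  + apply: (vanish _ (lin_serre _ i j (dual_linF lam))) => // w.
    by apply: dual_serreF => //; apply: is_kwt_word.
exists M.
have [x ex] := onto dual_hw (Fspan_word _ _ [::]).
have hx : in_wtsp lam x.
  by move=> i; apply: inj; have [_ _ -> _] := op i x; rewrite ex hwt (lin_Z linc) ex.
have Ex i : uE M i x = 0.
  by apply: inj; have [-> _ _ _] := op i x; rewrite ex dual_hw_E (lin_0 linc).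
have inc_word w : inc (foldr (uF M) x w) = foldr (dualF lam) dual_hw w.
  elim: w => //= i w IH; have [_ -> _ _] := op i (foldr (uF M) x w); by rewrite IH.
have span y : Fspan (uF M) x y.
  have [s es] := incS y; exists s; apply: inj; rewrite es.
  elim: (s) => [|p t IH]; first by rewrite !big_nil (lin_0 linc).
  by rewrite !big_cons (lin_D linc) (lin_Z linc) inc_word IH.
have gx : generates x by move=> P hP Px y; apply: submod_Fspan (span y).
have VM : Verma_quotient lam M by exists x.
(* As a highest weight module, [M] lies in O and so in C^hi, which makes the [E_i] locally
   nilpotent; every nonzero submodule then contains a nonzero vector killed by all [E_i]. *)
have [_ nil] := in_O_in_Chi (Verma_quotient_in_O VM).
split=> //; split.
  exists x; apply/eqP => x0; have := congr1 (fun f => f [::]) ex.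
  by rewrite x0 (lin_0 linc) => /esym/eqP; rewrite -[X in _ == X]/(0 : Qv) /dual_hw eqxx oner_eq0.
move=> P hP; case: (pselect (forall y, P y -> y = 0)) => [|nP]; [by left|right].
have [y [Py y0]] : exists y, P y /\ y != 0.
  apply: contra_notP nP => h y Py; apply/eqP/negPn/negP => y0; apply: h.
  by exists y.
have [n0 hn] := nil y; have [P0 PD PZ Pop] := hP.
have [|z [Pz z0 Ez]] := @exists_E_invariant M P n0 y _ Py y0 hn.
  by move=> i u /(Pop i) [].
(* Being killed by every [dualE i] says that [inc z] vanishes on all nonempty words, so it is a
   multiple of the delta function at the empty word. *)
have ez : z = inc z [::] *: x.
  apply: inj; rewrite (lin_Z linc) ex; apply: funext => -[|i w].
    by rewrite -[RHS]/(inc z [::] * 1) mulr1.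
  rewrite -[RHS]/(inc z [::] * 0) mulr0.
  have [e _ _ _] := op i z; rewrite Ez (lin_0 linc) in e.
  by rewrite -[LHS]/(dualE i (inc z) w) -e.
have c0 : inc z [::] != 0.
  by apply: contra_neq z0 => c0; rewrite ez c0 scale0r.
apply: gx => //.
by rewrite -[x](scalerK c0) -ez; apply: PZ.
Qed.

Theorem theorem9p4 :
  (* (1) category C^hi *)
  ((forall lam : weight, exists M : Umod, in_Chi M /\ isL lam M) /\
   (forall (lam : weight) (M N : Umod), isL lam M -> isL lam N -> Umod_iso M N) /\
   (forall (lam mu : weight) (M N : Umod), isL lam M -> isL mu N -> Umod_iso M N ->
      lam =1 mu) /\
   (forall M : Umod, in_Chi M -> irreducible M -> exists lam : weight, isL lam M))
  /\
  (* (2) category O *)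
  ((forall lam : weight, exists M : Umod, in_O M /\ isL lam M) /\
   (forall (lam : weight) (M N : Umod), isL lam M -> isL lam N -> Umod_iso M N) /\
   (forall (lam mu : weight) (M N : Umod), isL lam M -> isL mu N -> Umod_iso M N ->
      lam =1 mu) /\
   (forall M : Umod, in_O M -> irreducible M -> exists lam : weight, isL lam M)).
Proof.
have C : forall M, in_Chi M -> irreducible M -> exists lam, isL lam M by exact: in_Chi_isL.
(* A single module represents [lam] in both categories, and the inclusion of O in C^hi reduces the
   classification of irreducibles in O to that in C^hi. *)
have O lam : exists M, [/\ in_Chi M, in_O M & isL lam M].
  have [M LM] := exists_isL lam; have OM := Verma_quotient_in_O (proj2 LM).
  by exists M; split=> //; apply: in_O_in_Chi.
split; split.
- by move=> lam; have [M [hC _ hL]] := O lam; exists M.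
- by split; [exact: isL_iso | split; [exact: isL_weight_inj | exact: C]].
- by move=> lam; have [M [_ hO hL]] := O lam; exists M.
split; [exact: isL_iso | split; [exact: isL_weight_inj | move=> M hM]].
exact/C/in_O_in_Chi.
Qed.
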